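(* Let $\Gamma$ be a graph. If the graph monoid $M(\Gamma)$ is unconcealable, then $\Gamma = \overline{E_{i,j}}$ (up to isomorphism of graphs) for some $i, j \geq 0$.
   Context: A graph $\Gamma$ is a set $V(\Gamma)$ of vertices together with a reflexive, symmetric relation $E(\Gamma) \subseteq V(\Gamma) \times V(\Gamma)$; vertices $u,v$ are adjacent if $(u,v) \in E(\Gamma)$. The degree of a vertex is the number of vertices adjacent to and distinct from it. An embedding of graphs is a map on vertices which is injective and preserves both adjacency and non-adjacency. The complement $\overline{\Gamma}$ is the graph with the same vertex set as $\Gamma$, in which two distinct vertices are adjacent exactly if they are not adjacent in $\Gamma$. For $i,j \geq 0$, $E_{i,j}$ is the unique graph with $i$ vertices of degree $0$ and $2j$ vertices of degree $1$ (and no other vertices). The graph monoid $M(\Gamma)$ is the monoid with presentation $\langle V(\Gamma) \mid ab = ba \text{ for all } (a,b) \in E(\Gamma) \rangle$. The graph monoid $M(\Gamma)$ is called unconcealable if it embeds (as a monoid) into a graph monoid $M(\Omega)$ only when $\Gamma$ embeds into $\Omega$.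
   Formalization: The graph Γ is assumed finite; for infinite Γ the claim fails, e.g. the countably infinite complete graph has an unconcealable graph monoid but is not the complement of any E_{i,j} with natural numbers i, j. *)

(* Defs.v *)
From HB Require Import structures.
From mathcomp Require Import all_boot.
From mathcomp Require Import boolp classical_sets cardinality.

Set Implicit Arguments.
Unset Strict Implicit.
Unset Printing Implicit Defensive.

Local Open Scope classical_set_scope.
Local Open Scope card_scope.
Local Open Scope quotient_scope.

(* Vertex sets are arbitrary, possibly infinite; classically every type carries
   a choiceType structure.  Adjacency is reflexive, so every vertex is adjacent
   to itself. *)
Record graph := Graph {
  vertex : choiceType;
  adj : vertex -> vertex -> Prop;
  adj_refl : forall u, adj u u;
  adj_sym : forall u v, adj u v -> adj v u
}.

Definition has_degree (G : graph) (u : vertex G) (n : nat) : Prop :=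
  [set v | adj u v /\ v <> u] #= `I_n.

Definition finite_graph (G : graph) : Prop := finite_set [set: vertex G].

Definition graph_embedding (G H : graph) (f : vertex G -> vertex H) : Prop :=
  injective f /\ (forall u v, adj u v <-> adj (f u) (f v)).

Definition graph_embeds (G H : graph) : Prop :=
  exists f : vertex G -> vertex H, graph_embedding f.

Definition graph_iso (G H : graph) : Prop :=
  exists f : vertex G -> vertex H, graph_embedding f /\ bijective f.

Definition compl_adj (G : graph) (u v : vertex G) : Prop :=
  u = v \/ ~ adj u v.

Lemma compl_adj_refl (G : graph) (u : vertex G) : compl_adj u u.
Proof. by left. Qed.

Lemma compl_adj_sym (G : graph) (u v : vertex G) :
  compl_adj u v -> compl_adj v u.
Proof. by case=> [->|nuv]; [left|right=> /adj_sym]. Qed.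

Definition compl (G : graph) : graph :=
  Graph (@compl_adj_refl G) (@compl_adj_sym G).

(* E is E_{i,j}: these degrees determine E up to isomorphism, since the vertices
   of degree 1 are paired off by their edges. *)
Definition is_E (i j : nat) (E : graph) : Prop :=
  [/\ [set v : vertex E | has_degree v 0] #= `I_i,
      [set v : vertex E | has_degree v 1] #= `I_(2 * j)
    & forall v : vertex E, has_degree v 0 \/ has_degree v 1].

(* The least monoid congruence on the free monoid of words over X which
   contains R. *)
Inductive pres_cong (X : choiceType) (R : seq X -> seq X -> Prop) :
    seq X -> seq X -> Prop :=
  | pres_cong_rel u v : R u v -> pres_cong R u v
  | pres_cong_refl u : pres_cong R u u
  | pres_cong_sym u v : pres_cong R u v -> pres_cong R v u
  | pres_cong_trans u v w :
      pres_cong R u v -> pres_cong R v w -> pres_cong R u w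
  | pres_cong_cat u u' v v' :
      pres_cong R u u' -> pres_cong R v v' -> pres_cong R (u ++ v) (u' ++ v').

Definition pres_eqv (X : choiceType) (R : seq X -> seq X -> Prop) :
  rel (seq X) := fun u v => `[< pres_cong R u v >].

Lemma pres_eqv_refl (X : choiceType) (R : seq X -> seq X -> Prop) :
  reflexive (pres_eqv R).
Proof. by move=> u; apply/asboolP/pres_cong_refl. Qed.

Lemma pres_eqv_sym (X : choiceType) (R : seq X -> seq X -> Prop) :
  symmetric (pres_eqv R).
Proof. by move=> u v; apply/asboolP/asboolP; apply: pres_cong_sym. Qed.

Lemma pres_eqv_trans (X : choiceType) (R : seq X -> seq X -> Prop) :
  transitive (pres_eqv R).
Proof.
by move=> v u w /asboolP uv /asboolP vw; apply/asboolP/(pres_cong_trans uv).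
Qed.

Definition pres_equiv (X : choiceType) (R : seq X -> seq X -> Prop) :
  equiv_rel (seq X) :=
  EquivRel (pres_eqv R)
    (@pres_eqv_refl X R) (@pres_eqv_sym X R) (@pres_eqv_trans X R).

(* The monoid with presentation < X | u = v for all (u, v) in R >. *)
Definition pres_monoid (X : choiceType) (R : seq X -> seq X -> Prop) :=
  {eq_quot pres_equiv R}.

HB.instance Definition _ (X : choiceType) (R : seq X -> seq X -> Prop) :=
  Choice.on (pres_monoid R).

Definition pres_word (X : choiceType) (R : seq X -> seq X -> Prop)
  (w : seq X) : pres_monoid R := \pi_({eq_quot pres_equiv R}) w.

Lemma pres_wordE (X : choiceType) (R : seq X -> seq X -> Prop) (u v : seq X) :
  pres_word R u = pres_word R v <-> pres_cong R u v.
Proof.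
split=> [/eqP|uv]; first by rewrite eqmodE => /asboolP.
by apply/eqP; rewrite eqmodE; apply/asboolP.
Qed.

Definition pres_mul (X : choiceType) (R : seq X -> seq X -> Prop)
  (x y : pres_monoid R) : pres_monoid R :=
  pres_word R
    (repr (x : {eq_quot pres_equiv R}) ++ repr (y : {eq_quot pres_equiv R})).

Lemma pres_word_surj (X : choiceType) (R : seq X -> seq X -> Prop)
  (x : pres_monoid R) : exists w, x = pres_word R w.
Proof.
by exists (repr (x : {eq_quot pres_equiv R})); rewrite /pres_word reprK.
Qed.

Lemma pres_mulE (X : choiceType) (R : seq X -> seq X -> Prop) (u v : seq X) :
  pres_mul (pres_word R u) (pres_word R v) = pres_word R (u ++ v).
Proof.
by apply/pres_wordE; apply: pres_cong_cat; apply/pres_wordE;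
  rewrite {1}/pres_word reprK.
Qed.

Lemma pres_mulA (X : choiceType) (R : seq X -> seq X -> Prop) :
  associative (@pres_mul X R).
Proof.
move=> x y z; have [u ->] := pres_word_surj x; have [v ->] := pres_word_surj y.
by have [w ->] := pres_word_surj z; rewrite !pres_mulE catA.
Qed.

Lemma pres_mul1x (X : choiceType) (R : seq X -> seq X -> Prop) :
  left_id (pres_word R [::]) (@pres_mul X R).
Proof. by move=> x; have [u ->] := pres_word_surj x; rewrite pres_mulE. Qed.

Lemma pres_mulx1 (X : choiceType) (R : seq X -> seq X -> Prop) :
  right_id (pres_word R [::]) (@pres_mul X R).
Proof.
by move=> x; have [u ->] := pres_word_surj x; rewrite pres_mulE cats0.
Qed.

HB.instance Definition _ (X : choiceType) (R : seq X -> seq X -> Prop) :=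
  isMonoid.Build (pres_monoid R)
    (@pres_mulA X R) (@pres_mul1x X R) (@pres_mulx1 X R).

Definition comm_rel (G : graph) (u v : seq (vertex G)) : Prop :=
  exists a b : vertex G, [/\ adj a b, u = [:: a; b] & v = [:: b; a]].

Definition graph_monoid (G : graph) : monoidType :=
  pres_monoid (@comm_rel G).

Definition monoid_embeds (M N : monoidType) : Prop :=
  exists2 f : M -> N, monoid_morphism f & injective f.

Definition unconcealable (G : graph) : Prop :=
  forall H : graph,
    monoid_embeds (graph_monoid G) (graph_monoid H) -> graph_embeds G H.

(* Main.v *)
(* A trace is determined by its projections onto the pairs of letters that do
   not commute and onto single letters.  Hence M(Gamma) embeds into a product of
   copies of free monoids of rank 2 and 1, which is M(Omega) for a graph Omega
   in which no vertex has more than one non-neighbour.  If Gamma embeds into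
   Omega, then no vertex of Gamma has more than one non-neighbour either. *)

Require Import Defs.
From mathcomp Require Import all_boot.
From mathcomp Require Import finmap boolp classical_sets cardinality.

Set Implicit Arguments.
Unset Strict Implicit.
Unset Printing Implicit Defensive.

Local Open Scope classical_set_scope.
Local Open Scope card_scope.
Local Open Scope quotient_scope.

(** * Traces and their projections onto pairs of letters *)

Lemma comm_cong_catC (G : graph) (u v : seq (vertex G)) :
  (forall x y, x \in u -> y \in v -> adj x y) ->
  pres_cong (@comm_rel G) (u ++ v) (v ++ u).
Proof.
elim: u => [|a u IHu] uv; first by rewrite cats0; apply: pres_cong_refl.
have av y : y \in v -> adj a y by apply: uv; rewrite mem_head.
have {}IHu : pres_cong (@comm_rel G) (u ++ v) (v ++ u).
  by apply: IHu => x y xu; apply: uv; rewrite inE xu orbT.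
apply: (@pres_cong_trans _ _ _ ([:: a] ++ (v ++ u))).
  exact: (@pres_cong_cat _ _ [:: a] [:: a] _ _ (pres_cong_refl _ _) IHu).
rewrite catA -[a :: u]cat1s catA; apply: pres_cong_cat; last first.
  exact: pres_cong_refl.
elim: v {uv IHu} av => [|b v IHv] av; first exact: pres_cong_refl.
apply: (@pres_cong_trans _ _ _ ([:: b; a] ++ v)).
  apply: (@pres_cong_cat _ _ [:: a; b] _ v v); last exact: pres_cong_refl.
  by apply: pres_cong_rel; exists a, b; split=> //; apply: av; rewrite mem_head.
apply: (@pres_cong_cat _ _ [:: b] [:: b] (a :: v) (v ++ [:: a])).
  exact: pres_cong_refl.
by apply: IHv => y yv; apply: av; rewrite inE yv orbT.
Qed.

(** A generating relation affects the projection only if both of its letters are kept. Being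
    adjacent and among [a], [b], they are then the same letter. *)
Lemma comm_cong_filter (G : graph) (a b : vertex G) (u v : seq (vertex G)) :
  a = b \/ ~ adj a b -> pres_cong (@comm_rel G) u v ->
  filter (pred2 a b) u = filter (pred2 a b) v.
Proof.
move=> ab; elim=> {u v} //.
- move=> _ _ [x [y [xy -> ->]]] /=.
  case: ifP => [|_]; last by [].
  case: ifP => [/pred2P yab /pred2P xab|//].
  suff -> : x = y by [].
  case: yab xab ab xy => -> [] -> // [] //.
  by move=> nab /adj_sym.
- by move=> u v w _ -> _ ->.
- by move=> u u' v v' _ uu' _ vv'; rewrite !filter_cat uu' vv'.
Qed.

(** Induction on [u]: its first letter [a] occurs in [v], commutes with everything before its first
    occurrence there, and so can be moved to the front and cancelled. *)
Lemma filter_comm_cong (G : graph) (u v : seq (vertex G)) :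
  (forall a b, a = b \/ ~ adj a b ->
     filter (pred2 a b) u = filter (pred2 a b) v) ->
  pres_cong (@comm_rel G) u v.
Proof.
elim: u v => [|a u IHu] v uv.
  case: v uv => [|b v] uv; first exact: pres_cong_refl.
  by have := uv b b (or_introl erefl); rewrite /= eqxx.
have av : has (pred1 a) v.
  have : a \in filter (pred2 a a) (a :: u).
    by rewrite mem_filter /= eqxx mem_head.
  rewrite (uv a a (or_introl erefl)) mem_filter => /andP[_ av].
  by apply/hasP; exists a => /=.
case: (split_find av) uv => _ v1 v2 /eqP -> av1 uv; rewrite cat_rcons in uv *.
have nav1 : a \notin v1 by rewrite -has_pred1.
have adja x : x \in v1 -> adj a x.
  (* Otherwise the projections onto [a], [x] agree; that of the first word begins with [a], that of
     the second with a letter of [v1], which differs from [a]. *)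
  move=> xv1; apply: contrapT => nax.
  have := uv a x (or_intror nax); rewrite filter_cat /= eqxx.
  have : {subset filter (pred2 a x) v1 <= v1}.
    by move=> y; rewrite mem_filter => /andP[].
  have : x \in filter (pred2 a x) v1 by rewrite mem_filter /= eqxx orbT.
  case: (filter _ v1) => // c w _ /(_ c (mem_head _ _)) cv1 [ac _].
  by rewrite -ac (negbTE nav1) in cv1.
apply: (@pres_cong_trans _ _ _ ([:: a] ++ (v1 ++ v2))).
  apply: (@pres_cong_cat _ _ [:: a] [:: a] u (v1 ++ v2)).
    exact: pres_cong_refl.
  apply: IHu => b c bc; have := uv b c bc.
  rewrite !filter_cat /=; case: ifP => // /pred2P abc.
  (* Here [a] is [b] or [c]. A letter of [v1] that is kept would be the other one, distinct from [a]
     and adjacent to it. *)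
  suff -> : filter (pred2 b c) v1 = [::] by move=> [].
  apply/eqP; rewrite -(negbK (_ == _)) -has_filter; apply/hasPn => x xv1.
  apply/negP => /pred2P xbc; have ax := adja _ xv1.
  have neq : a <> x by move=> ax'; rewrite ax' xv1 in nav1.
  case: abc xbc ax neq bc => -> [] -> // /[swap] neq.
    by move=> bc [].
  by move=> /adj_sym bc [/esym|].
rewrite catA -[a :: v2]cat1s catA; apply: pres_cong_cat.
  by apply: comm_cong_catC => x y /[!inE] /eqP ->; apply: adja.
exact: pres_cong_refl.
Qed.

(** * The embedding into the monoid of the pair graph *)

(* The letter (a, b) is the copy of a in the free monoid on {a, b}: its only
   possible non-neighbour is (b, a). *)
Definition pair_adj (G : graph) (p q : vertex G * vertex G) : Prop :=
  q = (p.2, p.1) -> adj p.1 p.2.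

Lemma pair_adj_refl (G : graph) (p : vertex G * vertex G) : pair_adj p p.
Proof. by case: p => a b [-> _]; apply: adj_refl. Qed.

Lemma pair_adj_sym (G : graph) (p q : vertex G * vertex G) :
  pair_adj p q -> pair_adj q p.
Proof.
by case: p q => [a b] [c d] pq [ad bc]; subst d c; apply/adj_sym/pq.
Qed.

Definition pair_graph (G : graph) : graph :=
  Graph (@pair_adj_refl G) (@pair_adj_sym G).

(** Each letter [x] becomes the block of all [(x, y)]. The projection keeps one letter of it,
    [(a, b)] or [(b, a)], if [x] is [a] or [b], and none otherwise; this covers [a = b] too. *)
Lemma filter_pair_word (T : eqType) (s u : seq T) (a b : T) :
  uniq s -> (forall x, x \in s) ->
  map fst (filter (pred2 (a, b) (b, a)) [seq (x, y) | x <- u, y <- s]) =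
  filter (pred2 a b) u.
Proof.
move=> us sT; elim: u => [//|x u IHu].
rewrite allpairs_cons filter_cat map_cat IHu /= filter_map -map_comp.
have [-> | xa] /= := eqVneq x a.
  rewrite (@eq_filter _ _ (pred1 b)); last first.
    move=> y /=; rewrite !xpair_eqE eqxx /=.
    by have [->|//] := eqVneq a b; rewrite ?orbb ?orbF.
  by rewrite filter_pred1_uniq.
have [-> | xb] /= := eqVneq x b.
  rewrite (@eq_filter _ _ (pred1 a)); last first.
    move=> y /=; rewrite !xpair_eqE eqxx /=.
    by have [->|//] := eqVneq b a; rewrite ?orbb ?orbF.
  by rewrite filter_pred1_uniq.
rewrite (@eq_filter _ _ pred0) ?filter_pred0 // => y /=.
by rewrite !xpair_eqE (negbTE xa) (negbTE xb).
Qed.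

Lemma pair_word_cong (G : graph) (s u v : seq (vertex G)) :
  pres_cong (@comm_rel G) u v ->
  pres_cong (@comm_rel (pair_graph G))
    [seq (x, y) | x <- u, y <- s] [seq (x, y) | x <- v, y <- s].
Proof.
elim=> {u v}.
- move=> _ _ [a [b [ab -> ->]]]; rewrite /= !cats0.
  apply: (@comm_cong_catC (pair_graph G)).
  (* Letters [(a, c)] and [(b, d)] of the two blocks can fail to commute only if [c = b] and
     [d = a], and then [adj a b] makes them commute. *)
  by move=> _ _ /mapP[c _ ->] /mapP[d _ ->] [bc _] /=; rewrite -bc.
- by move=> u; apply: pres_cong_refl.
- by move=> u v _; apply: pres_cong_sym.
- by move=> u v w _ uv _ vw; apply: pres_cong_trans uv vw.
- by move=> u u' v v' _ uu' _ vv'; rewrite !allpairs_cat; apply: pres_cong_cat.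
Qed.

Lemma pair_word_cong_inj (G : graph) (s u v : seq (vertex G)) :
  uniq s -> (forall x, x \in s) ->
  pres_cong (@comm_rel (pair_graph G))
    [seq (x, y) | x <- u, y <- s] [seq (x, y) | x <- v, y <- s] ->
  pres_cong (@comm_rel G) u v.
Proof.
move=> us sT uv; apply: filter_comm_cong => a b ab.
rewrite -!(filter_pair_word _ _ _ us sT); congr map.
apply: (@comm_cong_filter (pair_graph G)) uv.
case: ab => [->|nab]; [by left | by right=> /(_ erefl)].
Qed.

Lemma graph_monoid_embeds_pair (G : graph) :
  finite_graph G ->
  monoid_embeds (graph_monoid G) (graph_monoid (pair_graph G)).
Proof.
move=> /finite_seqP[s0 sE]; pose s := undup s0.
have us : uniq s by apply: undup_uniq.
have sT x : x \in s.
  by rewrite mem_undup; have : [set: vertex G] x by []; rewrite sE.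
(* [F] is defined through chosen representatives; [FE] shows that the choice does not matter. *)
pose F (x : graph_monoid G) : graph_monoid (pair_graph G) :=
  pres_word (@comm_rel (pair_graph G))
    [seq (a, b) | a <- repr (x : {eq_quot pres_equiv (@comm_rel G)}), b <- s].
have FE w : F (pres_word (@comm_rel G) w) =
    pres_word (@comm_rel (pair_graph G)) [seq (a, b) | a <- w, b <- s].
  apply/pres_wordE; apply: pair_word_cong; apply/pres_wordE.
  by rewrite {1}/pres_word reprK.
exists F.
  split=> [|x y]; first exact: (FE [::]).
  have [u ->] := pres_word_surj x; have [v ->] := pres_word_surj y.
  rewrite [(_ * _)%g]pres_mulE !FE allpairs_cat.
  by symmetry; apply: pres_mulE.
move=> x y; have [u ->] := pres_word_surj x; have [v ->] := pres_word_surj y.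
rewrite !FE => /pres_wordE uv; apply/pres_wordE.
exact: pair_word_cong_inj uv.
Qed.

(** * Matchings given by an involution *)

Lemma fpf_involution_card (T : choiceType) (s : T -> T) (X : {fset T}) :
  involutive s -> (forall x, x \in X -> s x \in X /\ s x != x) ->
  ~~ odd #|` X|.
Proof.
move=> sK; move En: #|` X| => n.
elim/ltn_ind: n X En => n IHn X En sX.
have [X0|[x xX]] := fset_0Vmem X; first by rewrite -En X0 cardfs0.
have [sxX sxx] := sX x xX; pose Y := ((X `\ x) `\ s x)%fset.
have En2 : n = (#|` Y|).+2.
  by rewrite -En (cardfsD1 x) xX (cardfsD1 (s x)) !inE sxx sxX.
rewrite En2 /= negbK; apply: (IHn _ _ Y) => //; first by rewrite En2.
move=> y; rewrite !inE => /and3P[ysx yx yX]; have [-> ->] := sX y yX.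
by rewrite (can_eq sK) yx -(can_eq sK) sK ysx.
Qed.

Lemma has_degree0P (G : graph) (u : vertex G) :
  has_degree u 0 <-> forall v, adj u v -> v = u.
Proof.
rewrite /has_degree II0 card_eq0; split=> [/eqP u0 v uv|u0].
  apply: contrapT => vu.
  by have : [set v | adj u v /\ v <> u] v by []; rewrite u0.
by apply/eqP/seteqP; split=> // v [/u0].
Qed.

Lemma has_degree1P (G : graph) (u : vertex G) :
  has_degree u 1 <->
  exists2 v, adj u v /\ v <> u & forall w, adj u w -> w <> u -> w = v.
Proof.
rewrite /has_degree; split=> [/eq_cardSP[v uv]|[v uv vP]].
  rewrite II0 card_eq0 => /eqP u0; exists v => // w uw wu.
  apply: contrapT => wv.
  by have : ([set v | adj u v /\ v <> u] `\ v) w by []; rewrite u0.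
suff -> : [set w | adj u w /\ w <> u] = [set v] by apply: card_set1.
by apply/seteqP; split=> [w [uw wu]|_ ->//]; apply: vP.
Qed.

(** By injectivity of [f], a vertex has at most one neighbour, the one sent to [s (f u)]. The
    pairing is read off in [T], since [s] need not act on the vertices of [E]. *)
Lemma matching_is_E (E : graph) (T : choiceType) (s : T -> T)
    (f : vertex E -> T) :
  finite_graph E -> injective f -> involutive s ->
  (forall u v, adj u v -> v <> u -> f v = s (f u)) ->
  exists i j, is_E i j E.
Proof.
move=> finE injf sK fs.
have deg (v : vertex E) : has_degree v 0 \/ has_degree v 1.
  have [[w [vw wv]]|nv] := pselect (exists w, adj v w /\ w <> v).
    right; apply/has_degree1P; exists w => // x vx xv.
    by apply: injf; rewrite (fs _ _ vx xv) (fs _ _ vw wv).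
  left; apply/has_degree0P => w vw; apply: contrapT => wv.
  by apply: nv; exists w.
have fin (A : set (vertex E)) : finite_set A by apply: sub_finite_set finE.
set D := [set v : vertex E | has_degree v 1].
have [i Di] : finite_set [set v : vertex E | has_degree v 0] by apply: fin.
have finfD : finite_set (f @` D) by apply: finite_image.
exists i, (#|` fset_set (f @` D)|)./2; split=> //.
rewrite mul2n even_halfK; last first.
  (* The image of [D] is stable under [s], since the neighbour of a vertex of degree 1 has degree 1
     as well; there is no fixed point, since neighbours here are distinct. *)
  apply: (fpf_involution_card sK) => _ /[!in_fset_set]// /set_mem[u Du <-].
  have /has_degree1P[v [uv vu] _] := Du; rewrite -(fs _ _ uv vu).
  split; last by apply/eqP => /injf.
  apply/mem_set; exists v => //; case: (deg v) => // /has_degree0P v0.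
  by case: vu; rewrite (v0 u) //; apply: adj_sym.
rewrite -(card_eql (inj_card_eq (f := f) (A := D) _)); last first.
  by move=> ? ? _ _ /injf.
rewrite -[X in X #= _](fset_setK finfD); exact/card_eq_fsetP.
Qed.

Lemma graph_iso_compl_compl (G : graph) : graph_iso G (compl (compl G)).
Proof.
exists id; split; last by exists id.
split=> // u v; split=> [uv|[<-|nuv]]; last first.
- by apply: contrapT => uv; apply: nuv; right.
- exact: adj_refl.
- have [->|neq] := pselect (u = v); first by left.
  by right=> -[].
Qed.

Theorem proposition18 (G : graph) (finG : finite_graph G) :
  unconcealable G ->
  exists (i j : nat) (E : graph), is_E i j E /\ graph_iso G (compl E).
Proof.
move=> /(_ _ (graph_monoid_embeds_pair finG)) [f [injf fadj]].
have swapK : involutive (fun p : vertex G * vertex G => (p.2, p.1)) by case.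
have [||i [j ij]] := @matching_is_E (compl G) _ _ f _ injf swapK.
- exact: finG.
(* If [f v] were not the swap of [f u], the two would be adjacent in the pair graph vacuously, and
   [f] reflects adjacency. *)
- move=> u v [->//|nuv] _; apply: contrapT => fuv; apply: nuv.
  by apply/fadj => /fuv.
- by exists i, j, (compl G); split=> //; apply: graph_iso_compl_compl.
Qed.
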